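(* (Kolmogorov's inequality) Let $(\Omega,\mathscr{H},\widehat{\mathbb E})$ be a sub-linear expectation space and let $X_1,\ldots,X_n\in\mathscr{H}$ satisfy $\widehat{\mathbb E}[X_k]=0$ for $k=1,\ldots,n$. Suppose that $X_k$ is independent to $(X_{k+1},\ldots,X_n)$ for each $k=1,\ldots,n-1$. Put $S_k=X_1+\cdots+X_k$. Then $$\widehat{\mathbb E}\Big[\big(\max_{1\le k\le n}S_k\big)^2\Big]\le \sum_{k=1}^n\widehat{\mathbb E}[X_k^2].$$ In particular, $$\widehat{\mathbb E}\big[(S_n^+)^2\big]\le\sum_{k=1}^n\widehat{\mathbb E}[X_k^2].$$
   Context: Let $(\Omega,\mathcal F)$ be a measurable space. $C_{l,Lip}(\mathbb R^n)$ is the linear space of functions $\varphi:\mathbb R^n\to\mathbb R$ such that $|\varphi(x)-\varphi(y)|\le C(1+|x|^m+|y|^m)|x-y|$ for all $x,y\in\mathbb R^n$, for some $C>0$, $m\in\mathbb N$ depending on $\varphi$. $\mathscr H$ is a linear space of real functions on $(\Omega,\mathcal F)$ (called random variables) such that $X_1,\ldots,X_n\in\mathscr H$ implies $\varphi(X_1,\ldots,X_n)\in\mathscr H$ for every $\varphi\in C_{l,Lip}(\mathbb R^n)$. A sub-linear expectation on $\mathscr H$ is a functional $\widehat{\mathbb E}:\mathscr H\to[-\infty,\infty]$ such that for all $X,Y\in\mathscr H$: (a) $X\ge Y$ implies $\widehat{\mathbb E}[X]\ge\widehat{\mathbb E}[Y]$; (b) $\widehat{\mathbb E}[c]=c$ for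 constants $c$; (c) $\widehat{\mathbb E}[X+Y]\le\widehat{\mathbb E}[X]+\widehat{\mathbb E}[Y]$ whenever the right side is not of the form $+\infty-\infty$ or $-\infty+\infty$; (d) $\widehat{\mathbb E}[\lambda X]=\lambda\widehat{\mathbb E}[X]$ for $\lambda\ge0$. The triple $(\Omega,\mathscr H,\widehat{\mathbb E})$ is called a sub-linear expectation space. Independence (not symmetric): a random vector $\mathbf Y=(Y_1,\ldots,Y_n)$, $Y_i\in\mathscr H$, is independent to $\mathbf X=(X_1,\ldots,X_m)$, $X_i\in\mathscr H$, if for each $\varphi\in C_{l,Lip}(\mathbb R^m\times\mathbb R^n)$ one has $\widehat{\mathbb E}[\varphi(\mathbf X,\mathbf Y)]=\widehat{\mathbb E}\big[\widehat{\mathbb E}[\varphi(\mathbf x,\mathbf Y)]\big|_{\mathbf x=\mathbf X}\big]$ whenever $\overline\varphi(\mathbf x):=\widehat{\mathbb E}[|\varphi(\mathbf x,\mathbf Y)|]<\infty$ for all $\mathbf x$ and $\widehat{\mathbb E}[|\overline\varphi(\mathbf X)|]<\infty$. $x^+=\max(x,0)$. *)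

(* Defs.v *)
From HB Require Import structures.
From mathcomp Require Import all_boot all_order all_algebra.
From mathcomp Require Import all_classical all_reals all_analysis.

Set Implicit Arguments.
Unset Strict Implicit.
Unset Printing Implicit Defensive.
Import Order.TTheory GRing.Theory Num.Theory.

Local Open Scope classical_set_scope.
Local Open Scope ring_scope.

(* The library norm on 'rV[R]_n is the sup norm. *)
Definition enorm (R : realType) (n : nat) (x : 'rV[R]_n) : R :=
  Num.sqrt (\sum_(i < n) x 0 i ^+ 2).

Definition C_l_Lip (R : realType) (n : nat) : set ('rV[R]_n -> R) :=
  [set phi | exists (C : R) (m : nat), 0 < C /\
    forall x y : 'rV[R]_n,
      `|phi x - phi y| <= C * (1 + enorm x ^+ m + enorm y ^+ m) * enorm (x - y)].

Definition rvect (R : realType) (T : Type) (n : nat) (X : 'I_n -> T -> R)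
  (w : T) : 'rV[R]_n := \row_i X i w.

Record random_variable_space (R : realType) (d : measure_display)
    (T : measurableType d) (H : set (T -> R)) : Prop := {
  rvs_zero : H (fun=> 0);
  rvs_add : forall X Y : T -> R, H X -> H Y -> H (fun w => X w + Y w);
  rvs_scale : forall (a : R) (X : T -> R), H X -> H (fun w => a * X w);
  rvs_C_l_Lip : forall (n : nat) (X : 'I_n -> T -> R) (phi : 'rV[R]_n -> R),
    (forall i, H (X i)) -> @C_l_Lip R n phi -> H (fun w => phi (rvect X w)) }.

(* E is a total function, but only its values on H are constrained. In E_scale,
   0 * +oo = 0 * -oo = 0. *)
Record sublinear_expectation (R : realType) (d : measure_display)
    (T : measurableType d) (H : set (T -> R)) (E : (T -> R) -> \bar R)
    : Prop := {
  E_mono : forall X Y : T -> R, H X -> H Y ->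
    (forall w, Y w <= X w) -> (E Y <= E X)%E;
  E_cst : forall c : R, E (fun=> c) = c%:E;
  E_add : forall X Y : T -> R, H X -> H Y -> (E X +? E Y)%E ->
    (E (fun w => (X w + Y w)%R) <= E X + E Y)%E;
  E_scale : forall (a : R) (X : T -> R), H X -> 0 <= a ->
    E (fun w => a * X w) = (a%:E * E X)%E }.

Record sublinear_expectation_space (R : realType) (d : measure_display)
    (T : measurableType d) (H : set (T -> R)) (E : (T -> R) -> \bar R)
    : Prop := {
  sles_rvs : random_variable_space H;
  sles_E : sublinear_expectation H E }.

(* "Y is independent to X". R^m x R^n is 'rV_(m + n), with (x, y) = row_mx x y.
   phibar is everywhere finite under the first premise, and then so is
   x |-> E[phi(x, Y)], since |E[phi(x, Y)]| <= E[|phi(x, Y)|] < +oo; hence both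
   can be turned into real functions by fine. These functions need not belong
   to C_l_Lip, so the two memberships in H are the conditions for the outer
   expectations to make sense. *)
Definition independent_to (R : realType) (d : measure_display)
    (T : measurableType d) (H : set (T -> R)) (E : (T -> R) -> \bar R)
    (m n : nat) (Y : 'I_n -> T -> R) (X : 'I_m -> T -> R) : Prop :=
  forall phi : 'rV[R]_(m + n) -> R, @C_l_Lip R (m + n) phi ->
  let phibar (x : 'rV[R]_m) := E (fun w => `|phi (row_mx x (rvect Y w))|) in
  let inner (x : 'rV[R]_m) := E (fun w => phi (row_mx x (rvect Y w))) in
  (forall x, (phibar x < +oo)%E) ->
  H (fun w => fine (phibar (rvect X w))) ->
  (E (fun w => `|fine (phibar (rvect X w))|%R) < +oo)%E ->
  H (fun w => fine (inner (rvect X w))) ->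
  E (fun w => phi (row_mx (rvect X w) (rvect Y w))) =
  E (fun w => fine (inner (rvect X w))).

(* Sequences are indexed from 1, as X_1, X_2, ...; X 0 is never used. *)
Definition partial_sum (R : realType) (T : Type) (X : nat -> T -> R)
  (k : nat) (w : T) : R := \sum_(1 <= i < k.+1) X i w.

(* Meant for n >= 1: the default value is then the first term. *)
Definition max_partial_sum (R : realType) (T : Type) (X : nat -> T -> R)
    (n : nat) (w : T) : R :=
  \big[Num.max/partial_sum X 1 w]_(1 <= k < n.+1) partial_sum X k w.

(* (X_{k+1}, ..., X_n), the j-th entry being X_{k+1+j}. *)
Definition tail_vect (R : realType) (T : Type) (X : nat -> T -> R)
  (n k : nat) : 'I_(n - k) -> T -> R := fun j => X (k + j).+1.

(* Main.v *)
Require Import Defs.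
From HB Require Import structures.
From mathcomp Require Import all_boot all_order all_algebra.
From mathcomp Require Import all_classical all_reals all_analysis.
From mathcomp Require Import zify ring lra.

(** Write [M_k] for the positive part of the largest partial sum of the tail
    [X_k, ..., X_n].  Starting the sums one step earlier gives the recursion
    [M_k = (X_k + M_{k+1})^+], with [M_{n+1} = 0], and the maximum of the partial
    sums [S_1, ..., S_n] is exactly [X_1 + M_2] (lemma [max_partial_sumE]).  Now
<<
   (X_k + M_{k+1})^2 = X_k^2 + 2 M_{k+1} X_k + M_{k+1}^2
>>
    and the cross term has expectation zero.  Indeed [X_k] is independent to the
    tail, so that the tail can be frozen first: for fixed values of it, [M_{k+1}]
    is a nonnegative constant [t] and the inner expectation is
    [t * E[X_k] = 0].  The sign of [t] is essential, since a sublinear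
    expectation is only positively homogeneous, and [E[-X_k]] may be positive;
    this is why positive parts are kept.  The recursion runs from the last
    variable to the first because each [X_k] is independent to the later ones.
    Subadditivity then gives
    [E[(X_k + M_{k+1})^2] <= E[X_k^2] + E[M_{k+1}^2]] (lemma [E_sqrD_le]), and
    [M_k^2 <= (X_k + M_{k+1})^2] lets the bound be iterated down to [k = 1].

    Independence only speaks of test functions in [C_l_Lip] whose expectations
    are finite.  The test function here, [M_{k+1} X_k], is a product of two
    Lipschitz functions of the coordinates, hence in [C_l_Lip] (lemma
    [C_l_LipM]).  For finiteness, the bound is trivial if some [E[X_k^2]] is
    infinite; otherwise [|x| <= 1 + x^2] makes every [E[|X_k|]] finite, and
    [M_{k+1}] is at most the sum of the [|X_j|]. *)

Set Implicit Arguments.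
Unset Strict Implicit.
Unset Printing Implicit Defensive.
Import Order.TTheory GRing.Theory Num.Theory.

Local Open Scope classical_set_scope.
Local Open Scope ring_scope.

(** * Positive part of the maximal partial sum *)

(** The largest sum of a prefix of [s], the empty prefix included, computed by
    Lindley's recursion.  The recursive form, rather than a big maximum, makes
    stability under Lipschitz maps and under random variables plain inductions
    on [s]. *)
Definition max_prefix_sum (R : realType) (s : seq R) : R :=
  foldr (fun x t => Num.max (x + t) 0) 0 s.

Lemma max_prefix_sum_ge0 (R : realType) (s : seq R) : 0 <= max_prefix_sum s.
Proof. by case: s => [|x s] //=; rewrite le_max lexx orbT. Qed.

(** Lets the default value of a big maximum be traded for an extra term, which
    is how the defaults [0] and [S_1] below are reconciled. *)
Lemma bigmax_idx_max (R : realType) (I : Type) (r : seq I) (F : I -> R)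
    (a b : R) :
  \big[Num.max/Num.max a b]_(i <- r) F i = Num.max a (\big[Num.max/b]_(i <- r) F i).
Proof.
by elim: r => [|i r IH]; rewrite ?big_nil // !big_cons IH maxCA.
Qed.

Lemma addr_bigmax (R : realType) (I : Type) (r : seq I) (F : I -> R)
    (a b : R) :
  a + \big[Num.max/b]_(i <- r) F i = \big[Num.max/a + b]_(i <- r) (a + F i).
Proof. by rewrite (big_morph (fun t => a + t) (@addr_maxr _ a) erefl). Qed.

(** Adding the first term turns the partial sums that start at [m.+1] into those
    that start at [m]; this shift is the recursion behind [max_prefix_sum]. *)
Lemma addr_bigmax_partial_sums (R : realType) (x : nat -> R) (m l : nat) (b : R) :
  x m + \big[Num.max/b]_(m.+1 <= k < m.+1 + l) \sum_(m.+1 <= i < k.+1) x i =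
  \big[Num.max/x m + b]_(m.+1 <= k < m.+1 + l) \sum_(m <= i < k.+1) x i.
Proof.
rewrite addr_bigmax; apply: eq_big_nat => k /andP[mk _].
by rewrite [RHS]big_ltn // ltnS ltnW.
Qed.

Lemma max_prefix_sumE (R : realType) (x : nat -> R) (m l : nat) :
  max_prefix_sum [seq x j | j <- iota m l] =
  \big[Num.max/0]_(m <= k < m + l) \sum_(m <= i < k.+1) x i.
Proof.
elim: l m => [|l IH] m; first by rewrite addn0 big_geq.
rewrite /= -/(max_prefix_sum _) IH addr_bigmax_partial_sums addr0.
rewrite [RHS]big_ltn ?addnS ?ltnS ?leq_addr // big_nat1 -addSn.
by rewrite maxC -!bigmax_idx_max maxC.
Qed.

(** The first term stays outside the positive part because the maximum of
    [S_1, ..., S_n] ranges over nonempty sums and may be negative. *)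
Lemma max_partial_sumE (R : realType) (T : Type) (X : nat -> T -> R) (n : nat)
    (w : T) : (1 <= n)%N ->
  max_partial_sum X n w =
  X 1%N w + max_prefix_sum [seq X j w | j <- iota 2 n.-1].
Proof.
case: n => // n _; rewrite /max_partial_sum /partial_sum.
rewrite (max_prefix_sumE (X^~ w)) (@addr_bigmax_partial_sums _ (X^~ w)) addr0.
by rewrite big_ltn // big_nat1 -bigmax_idx_max maxxx.
Qed.

(** * Lipschitz functions and their products *)

Lemma enorm_ge0 (R : realType) (n : nat) (x : 'rV[R]_n) : 0 <= enorm x.
Proof. exact: sqrtr_ge0. Qed.

Lemma ler_coord_enorm (R : realType) (n : nat) (x : 'rV[R]_n) (i : 'I_n) :
  `|x 0 i| <= enorm x.
Proof.
rewrite -sqrtr_sqr ler_wsqrtr // (bigD1 i) //= lerDl.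
by apply: sumr_ge0 => j _; exact: sqr_ge0.
Qed.

Definition enorm_lipschitz (R : realType) (n : nat) (f : 'rV[R]_n -> R) : Prop :=
  exists2 L : R, 0 <= L & forall x y, `|f x - f y| <= L * enorm (x - y).

Lemma enorm_lipschitz_coord (R : realType) (n : nat) (i : 'I_n) :
  enorm_lipschitz (fun x : 'rV[R]_n => x 0 i).
Proof.
exists 1 => // x y; rewrite mul1r; apply: le_trans (ler_coord_enorm _ i).
by rewrite !mxE.
Qed.

Lemma enorm_lipschitz_cst (R : realType) (n : nat) (c : R) :
  enorm_lipschitz (fun _ : 'rV[R]_n => c).
Proof. by exists 0 => // x y; rewrite subrr normr0 mul0r. Qed.

Lemma enorm_lipschitzD (R : realType) (n : nat) (f g : 'rV[R]_n -> R) :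
  enorm_lipschitz f -> enorm_lipschitz g -> enorm_lipschitz (fun x => f x + g x).
Proof.
move=> [L L0 fL] [M M0 gM]; exists (L + M); first exact: addr_ge0.
move=> x y; rewrite mulrDl opprD addrACA.
by apply: le_trans (ler_normD _ _) _; apply: lerD.
Qed.

Lemma enorm_lipschitz_comp (R : realType) (n : nat) (g : R -> R)
    (f : 'rV[R]_n -> R) :
  (forall a b, `|g a - g b| <= `|a - b|) ->
  enorm_lipschitz f -> enorm_lipschitz (fun x => g (f x)).
Proof.
by move=> g1 [L L0 fL]; exists L => // x y; exact: le_trans (g1 _ _) (fL _ _).
Qed.

Lemma max0_nonexpansive (R : realType) (a b : R) :
  `|Num.max a 0 - Num.max b 0| <= `|a - b|.
Proof.
rewrite ler_norml; have := lerNnormlW (lexx `|a - b|).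
have := ler_norm (a - b); have := ler_norm (b - a); rewrite distrC.
by case: (leP a 0); case: (leP b 0) => ? ? ? ? ?; apply/andP; split; lra.
Qed.

Lemma enorm_lipschitz_max_prefix_sum (R : realType) (n : nat) (s : seq 'I_n) :
  enorm_lipschitz (fun x : 'rV[R]_n => max_prefix_sum [seq x 0 i | i <- s]).
Proof.
elim: s => [|i s IH]; first exact: enorm_lipschitz_cst.
apply: (enorm_lipschitz_comp (@max0_nonexpansive R)
          (f := fun x => x 0 i + max_prefix_sum [seq x 0 j | j <- s])).
exact: enorm_lipschitzD (enorm_lipschitz_coord _ i) IH.
Qed.

(** A Lipschitz function grows at most linearly, so in
    [f x * (g x - g y) + g y * (f x - f y)] each term is at most an affine
    function of the norms times the norm of [x - y]: degree [1] is enough. *)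
Lemma C_l_LipM (R : realType) (n : nat) (f g : 'rV[R]_n -> R) :
  enorm_lipschitz f -> enorm_lipschitz g -> @C_l_Lip R n (fun x => f x * g x).
Proof.
move=> [L L0 fL] [M M0 gM].
exists (`|f 0| * M + `|g 0| * L + L * M + 1), 1%N; split.
  by rewrite ltr_wpDl // !addr_ge0 // mulr_ge0.
move=> x y; rewrite !expr1.
have -> : f x * g x - f y * g y = f x * (g x - g y) + g y * (f x - f y) by ring.
apply: le_trans (ler_normD _ _) _; rewrite !normrM.
have fx : `|f x| <= `|f 0| + L * enorm x.
  by have := fL x 0; rewrite subr0; have := ler_normD (f x - f 0) (f 0);
    rewrite subrK; lra.
have gy : `|g y| <= `|g 0| + M * enorm y.
  by have := gM y 0; rewrite subr0; have := ler_normD (g y - g 0) (g 0);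
    rewrite subrK; lra.
apply: (@le_trans _ _ ((`|f 0| + L * enorm x) * (M * enorm (x - y)) +
                      (`|g 0| + M * enorm y) * (L * enorm (x - y)))).
  by apply: lerD; apply: ler_pM.
have := enorm_ge0 x; have := enorm_ge0 y; have := enorm_ge0 (x - y).
move: (enorm x) (enorm y) (enorm (x - y)) => a b c c0 b0 a0.
rewrite [X in X <= _](_ : _ = ((`|f 0| + L * a) * M + (`|g 0| + M * b) * L) * c);
  last by ring.
apply: ler_wpM2r => //.
have h1 : 0 <= `|f 0| * M * (a + b) by rewrite !mulr_ge0 ?addr_ge0.
have h2 : 0 <= `|g 0| * L * (a + b) by rewrite !mulr_ge0 ?addr_ge0.
have h3 : 0 <= L * M by rewrite mulr_ge0.
lra.
Qed.

Lemma C_l_Lip_lipschitz (R : realType) (n : nat) (f : 'rV[R]_n -> R) :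
  enorm_lipschitz f -> @C_l_Lip R n f.
Proof.
move=> fL; rewrite (_ : f = fun x => f x * 1); last first.
  by apply/funext => x; rewrite mulr1.
exact: C_l_LipM fL (enorm_lipschitz_cst _ _).
Qed.

(** * Closure properties of the space of random variables *)

Section random_variables.
Context (R : realType) (d : measure_display) (T : measurableType d).
Variables (H : set (T -> R)) (hH : random_variable_space H).

Lemma rvs_cst (c : R) : H (fun=> c).
Proof.
apply: (rvs_C_l_Lip hH (n := 0) (X := fun _ _ => 0) (phi := fun=> c)).
  by case.
exact: C_l_Lip_lipschitz (enorm_lipschitz_cst _ _).
Qed.

Lemma rvs_mul (X Y : T -> R) : H X -> H Y -> H (fun w => X w * Y w).
Proof.
move=> HX HY.
pose Z (i : 'I_2) := if i == ord0 then X else Y.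
rewrite (_ : (fun _ => _) =
    fun w => rvect Z w 0 ord0 * rvect Z w 0 ord_max); last first.
  by apply/funext => w; rewrite !mxE.
apply: (rvs_C_l_Lip hH (phi := fun z : 'rV_2 => z 0 ord0 * z 0 ord_max)).
  by move=> i; rewrite /Z; case: ifP.
exact: C_l_LipM (enorm_lipschitz_coord _ _) (enorm_lipschitz_coord _ _).
Qed.

Lemma rvs_sqr (X : T -> R) : H X -> H (fun w => X w ^+ 2).
Proof. by move=> HX; exact: rvs_mul. Qed.

Lemma rvs_nonexpansive (g : R -> R) (X : T -> R) :
  (forall a b, `|g a - g b| <= `|a - b|) -> H X -> H (fun w => g (X w)).
Proof.
move=> g1 HX.
rewrite (_ : (fun _ => _) =
    fun w => g (rvect (fun _ : 'I_1 => X) w 0 ord0)); last first.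
  by apply/funext => w; rewrite mxE.
apply: (rvs_C_l_Lip hH (phi := fun z : 'rV_1 => g (z 0 ord0))) => //.
exact/C_l_Lip_lipschitz/enorm_lipschitz_comp/enorm_lipschitz_coord.
Qed.

Lemma rvs_norm (X : T -> R) : H X -> H (fun w => `|X w|).
Proof. by apply: rvs_nonexpansive => a b; exact: ler_dist_dist. Qed.

Lemma rvs_max_prefix_sum (X : nat -> T -> R) (s : seq nat) :
  (forall j, j \in s -> H (X j)) ->
  H (fun w => max_prefix_sum [seq X j w | j <- s]).
Proof.
elim: s => [|j s IH] Hs; first exact: rvs_cst.
apply: (rvs_nonexpansive (@max0_nonexpansive R)
          (X := fun w => X j w + max_prefix_sum [seq X i w | i <- s])).
apply: rvs_add => //; first by apply: Hs; rewrite mem_head.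
by apply: IH => i si; apply: Hs; rewrite inE si orbT.
Qed.

Lemma rvs_partial_sum (X : nat -> T -> R) (n : nat) :
  (forall k, (1 <= k <= n)%N -> H (X k)) -> H (partial_sum X n).
Proof.
elim: n => [|n IH] HX.
  by rewrite (_ : partial_sum X 0 = fun=> 0); [exact: rvs_cst|
    apply/funext => w; rewrite /partial_sum big_geq].
rewrite (_ : partial_sum X n.+1 = fun w => partial_sum X n w + X n.+1 w).
  apply: rvs_add => //; last by apply: HX; rewrite /= leqnn.
  by apply: IH => k /andP[k1 kn]; apply: HX; rewrite k1 ltnW.
by apply/funext => w; rewrite /partial_sum big_nat_recr.
Qed.

End random_variables.

(** * Sublinear expectations of squares and cross terms *)

Section sublinear.
Context (R : realType) (d : measure_display) (T : measurableType d).
Variables (H : set (T -> R)) (E : (T -> R) -> \bar R).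
Hypothesis hE : sublinear_expectation_space H E.
Let hH := sles_rvs hE.
Let sE := sles_E hE.

Lemma sublinear_ge0 (X : T -> R) :
  H X -> (forall w, 0 <= X w) -> (0 <= E X)%E.
Proof.
move=> HX X0; rewrite (_ : 0%E = E (fun=> 0)); last by rewrite (E_cst sE).
by apply: (E_mono sE) => //; exact: rvs_cst.
Qed.

(** From the pointwise bound [|x| <= 1 + x^2]. *)
Lemma sublinear_norm_lty (X : T -> R) :
  H X -> (E (fun w => (X w ^+ 2)%R) < +oo)%E -> (E (fun w => `|X w|%R) < +oo)%E.
Proof.
move=> HX X2.
have H1 := rvs_cst hH 1; have HX2 := rvs_sqr hH HX.
apply: (@le_lt_trans _ _ (E (fun w => (1 + X w ^+ 2)%R))).
  apply: (E_mono sE); [exact: rvs_add|exact: rvs_norm|] => w.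
  by rewrite -real_normK ?num_real//; have := normr_ge0 (X w); nra.
apply: (le_lt_trans (E_add sE H1 HX2 _)); rewrite (E_cst sE).
  exact: fin_num_adde_defr.
by rewrite lte_add_pinfty ?ltry.
Qed.

(** By [(x + t)^+ <= |x| + t] for [t >= 0], along the recursion. *)
Lemma sublinear_max_prefix_sum_lty (X : nat -> T -> R) (s : seq nat) :
  (forall j, j \in s -> H (X j)) ->
  (forall j, j \in s -> (E (fun w => `|X j w|%R) < +oo)%E) ->
  (E (fun w => max_prefix_sum [seq X j w | j <- s]) < +oo)%E.
Proof.
elim: s => [|j s IH] Hs fins; first by rewrite (E_cst sE) ltry.
have Hj : H (X j) by apply: Hs; rewrite mem_head.
have sub i : i \in s -> i \in j :: s by rewrite inE => ->; rewrite orbT.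
have Hm := rvs_max_prefix_sum hH (fun i si => Hs i (sub i si)).
have finm := IH (fun i si => Hs i (sub i si)) (fun i si => fins i (sub i si)).
have Hn := rvs_norm hH Hj.
apply: (@le_lt_trans _ _
    (E (fun w => (`|X j w| + max_prefix_sum [seq X j w | j <- s])%R))).
  apply: (E_mono sE); [exact: rvs_add|exact: rvs_max_prefix_sum|] => w.
  have := max_prefix_sum_ge0 [seq X j w | j <- s].
  by rewrite /= ge_max => ?; rewrite lerD2r ler_norm addr_ge0.
apply: (le_lt_trans (E_add sE Hn Hm _)).
  apply: ge0_adde_def; rewrite inE; apply: sublinear_ge0 => // w.
  exact: max_prefix_sum_ge0.
by rewrite lte_add_pinfty // fins // mem_head.
Qed.

(** The cross term vanishes: given the tail [x], the conditional expectation is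
    [P x * E[X_k] = 0], by homogeneity for the nonnegative scalar [P x].  The
    same scalar gives [P x * E[|X_k|]] for the absolute value, whence the
    finiteness and membership conditions of independence. *)
Lemma E_mul_max_prefix_sum_eq0 (X : nat -> T -> R) (n k : nat) :
  (forall j, (k <= j <= n)%N -> H (X j)) -> (k <= n)%N -> E (X k) = 0%E ->
  (forall j, (k <= j <= n)%N -> (E (fun w => (X j w ^+ 2)%R) < +oo)%E) ->
  independent_to H E (fun _ : 'I_1 => X k) (@tail_vect R T X n k) ->
  E (fun w => max_prefix_sum [seq X j w | j <- iota k.+1 (n - k)] * X k w) = 0%E.
Proof.
move=> HX kn EX fin2 ind.
pose m := (n - k)%N.
pose P (x : 'rV[R]_m) := max_prefix_sum [seq x 0 j | j <- enum 'I_m].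
(* In [row_mx x y] the tail comes first and the value of [X_k] is the last
   coordinate. *)
pose phi (z : 'rV[R]_(m + 1)) :=
  max_prefix_sum [seq z 0 i | i <- [seq lshift 1 j | j <- enum 'I_m]] *
  z 0 (rshift m ord0).
have phiE x (y : 'rV_1) : phi (row_mx x y) = P x * y 0 ord0.
  rewrite /phi row_mxEr -map_comp; congr (max_prefix_sum _ * _).
  by apply: eq_map => j /=; rewrite row_mxEl.
have PE w : P (rvect (@tail_vect R T X n k) w) =
    max_prefix_sum [seq X j w | j <- iota k.+1 m].
  rewrite /P -[k.+1]addn0 iotaDl -val_enum_ord -!map_comp; congr max_prefix_sum.
  by apply: eq_map => j /=; rewrite mxE /tail_vect addSn.
have P0 x : 0 <= P x by exact: max_prefix_sum_ge0.
have kk : (k <= k <= n)%N by rewrite leqnn.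
have HXk := HX _ kk; have HXn := rvs_norm hH HXk.
have in_tail j : j \in iota k.+1 m -> (k <= j <= n)%N.
  by rewrite mem_iota /m; lia.
have En_lty := sublinear_norm_lty HXk (fin2 _ kk).
have En_ge0 : (0 <= E (fun w => `|X k w|%R))%E by exact: sublinear_ge0.
have En_fin : E (fun w => `|X k w|%R) \is a fin_num by rewrite ge0_fin_numE.
have phibarE x : E (fun w => `|phi (row_mx x (rvect (fun _ : 'I_1 => X k) w))|)
    = ((P x)%:E * E (fun w => `|X k w|%R))%E.
  rewrite -(E_scale sE) //; congr E; apply/funext => w.
  by rewrite phiE mxE normrM (ger0_norm (P0 x)).
have innerE x : E (fun w => phi (row_mx x (rvect (fun _ : 'I_1 => X k) w))) = 0%E.
  rewrite -[RHS](mule0 (P x)%:E) -EX -(E_scale sE) //; congr E; apply/funext => w.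
  by rewrite phiE mxE.
have Hm : H (fun w => max_prefix_sum [seq X j w | j <- iota k.+1 m]).
  by apply: rvs_max_prefix_sum => // j /in_tail /HX.
pose c := fine (E (fun w => `|X k w|%R)).
have c0 : 0 <= c by exact: fine_ge0.
have fine_phibar w :
    fine ((P (rvect (@tail_vect R T X n k) w))%:E * E (fun w => `|X k w|%R))%E =
    c * max_prefix_sum [seq X j w | j <- iota k.+1 m].
  by rewrite fineM // PE mulrC.
rewrite (_ : (fun _ => _) = fun w =>
    phi (row_mx (rvect (@tail_vect R T X n k) w)
                (rvect (fun _ : 'I_1 => X k) w))); last first.
  by apply/funext => w; rewrite phiE PE mxE.
rewrite ind.
- under eq_fun do rewrite innerE.
  exact: (E_cst sE).
- exact: C_l_LipM (enorm_lipschitz_max_prefix_sum _ _) (enorm_lipschitz_coord _ _).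
- by move=> x; rewrite phibarE lte_mul_pinfty ?lee_fin.
- under eq_fun do rewrite phibarE fine_phibar.
  exact: rvs_scale.
- under eq_fun do rewrite phibarE fine_phibar ger0_norm ?mulr_ge0 ?max_prefix_sum_ge0//.
  rewrite (E_scale sE) // lte_mul_pinfty ?lee_fin //.
  apply: sublinear_max_prefix_sum_lty => j /in_tail kj; first exact: HX.
  by apply: sublinear_norm_lty; [exact: HX|exact: fin2].
- under eq_fun do rewrite innerE.
  exact: rvs_cst.
Qed.

(** Subadditivity is applied twice to [X^2 + (2 Y X + Y^2)].  The finiteness of
    [E[X^2]] and the vanishing of [E[Y X]] ensure that no sum of opposite
    infinities is formed. *)
Lemma E_sqrD_le (X Y : T -> R) : H X -> H Y ->
  (E (fun w => (X w ^+ 2)%R) < +oo)%E -> E (fun w => Y w * X w) = 0%E ->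
  (E (fun w => ((X w + Y w) ^+ 2)%R) <=
     E (fun w => (X w ^+ 2)%R) + E (fun w => (Y w ^+ 2)%R))%E.
Proof.
move=> HX HY fX EYX.
have HX2 := rvs_sqr hH HX; have HY2 := rvs_sqr hH HY.
have HYX : H (fun w => 2 * (Y w * X w)) by apply: rvs_scale => //; exact: rvs_mul.
have EYX2 : E (fun w => 2 * (Y w * X w)) = 0%E.
  by rewrite (E_scale sE) // ?EYX ?mule0 //; exact: rvs_mul.
have X2fin : E (fun w => (X w ^+ 2)%R) \is a fin_num.
  by rewrite ge0_fin_numE // sublinear_ge0 // => w; exact: sqr_ge0.
rewrite (_ : (fun _ => _) = fun w => X w ^+ 2 + (2 * (Y w * X w) + Y w ^+ 2)).
  apply: (le_trans (E_add sE HX2 (rvs_add hH HYX HY2) _)).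
    exact: fin_num_adde_defr.
  apply: leeD2l; rewrite -[leRHS]add0e -EYX2; apply: (E_add sE) => //.
  by rewrite EYX2; exact: fin_num_adde_defr.
by apply/funext => w; ring.
Qed.

End sublinear.

Theorem theorem1p4 (R : realType) (d : measure_display) (T : measurableType d)
    (H : set (T -> R)) (E : (T -> R) -> \bar R)
    (hE : sublinear_expectation_space H E)
    (n : nat) (hn : (1 <= n)%N) (X : nat -> T -> R)
    (hX : forall k : nat, (1 <= k <= n)%N -> H (X k))
    (hX0 : forall k : nat, (1 <= k <= n)%N -> E (X k) = 0%E)
    (hind : forall k : nat, (1 <= k <= n.-1)%N ->
      independent_to H E (fun _ : 'I_1 => X k) (@tail_vect R T X n k)) :
  (E (fun w => (max_partial_sum X n w ^+ 2)%R)
     <= \sum_(1 <= k < n.+1) E (fun w => (X k w ^+ 2)%R))%E /\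
  (E (fun w => (Num.max (partial_sum X n w) 0 ^+ 2)%R)
     <= \sum_(1 <= k < n.+1) E (fun w => (X k w ^+ 2)%R))%E.
Proof.
have hH := sles_rvs hE; have sE := sles_E hE.
have X2_ge0 k : (1 <= k <= n)%N -> (0 <= E (fun w => (X k w ^+ 2)%R))%E.
  move=> kn; apply: (sublinear_ge0 hE); first exact (rvs_sqr hH (hX k kn)).
  by move=> w; exact: sqr_ge0.
pose M (m : nat) (w : T) := max_prefix_sum [seq X j w | j <- iota m (n.+1 - m)].
have HM m : (1 <= m)%N -> H (M m).
  move=> m1; apply: rvs_max_prefix_sum => // j; rewrite mem_iota => /andP[mj jn].
  by apply: hX; move: jn; lia.
have H1M : H (fun w => X 1%N w + M 2 w) := rvs_add hH (hX 1%N hn) (HM 2 isT).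
have maxE w : max_partial_sum X n w = X 1%N w + M 2 w.
  by rewrite max_partial_sumE // /M -subn1 subSS.
suff main : (E (fun w => ((X 1%N w + M 2 w) ^+ 2)%R)
    <= \sum_(1 <= k < n.+1) E (fun w => (X k w ^+ 2)%R))%E.
  split; first by under eq_fun do rewrite maxE.
  apply: le_trans main; apply: (E_mono sE).
  - exact: rvs_sqr.
  - apply: (rvs_sqr hH (X := fun w => Num.max (partial_sum X n w) 0)).
    exact: (rvs_nonexpansive hH (@max0_nonexpansive R) (rvs_partial_sum hH hX)).
  (* If [S_n <= 0] the square of its positive part is [0]; otherwise the maximum
     dominates [S_n > 0] and squaring is monotone. *)
  move=> w; rewrite -maxE; case: (leP (partial_sum X n w) 0) => [_|S_gt0].
    by rewrite expr0n sqr_ge0.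
  have SM : partial_sum X n w <= max_partial_sum X n w.
    by apply: (@le_bigmax_seq _ _ _ _ _ n predT); rewrite ?mem_index_iota ?hn /=.
  by rewrite lerXn2r // nnegrE ltW // (lt_le_trans S_gt0).
have [X2_fin|] := pselect (forall k, (1 <= k <= n)%N ->
    (E (fun w => (X k w ^+ 2)%R) < +oo)%E); last first.
  (* The right-hand side is infinite, its other terms being nonnegative. *)
  move=> /existsNP[k /not_implyP[kn /negP]]; rewrite -leNgt leye_eq => /eqP Xk2.
  rewrite (bigD1_seq k) ?mem_index_iota ?iota_uniq //= Xk2 addye ?leey //.
  rewrite gt_eqF // (lt_le_trans (ltNyr 0)) // big_seq_cond.
  by apply: sume_ge0 => j; rewrite mem_index_iota => /andP[/X2_ge0].
have step m : (1 <= m <= n)%N -> (E (fun w => ((X m w + M m.+1 w) ^+ 2)%R) <=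
    E (fun w => (X m w ^+ 2)%R) + E (fun w => (M m.+1 w ^+ 2)%R))%E.
  move=> mn; have /andP[m1 mn'] := mn.
  apply: (E_sqrD_le hE); [exact: hX|exact: HM|exact: X2_fin|].
  (* For [m = n] the tail is empty and the cross term is identically [0];
     independence is assumed for [m < n]. *)
  rewrite /M subSS; have [mltn|] := ltnP m n; last first.
    rewrite -subn_eq0 => /eqP -> /=.
    by under eq_fun do rewrite mul0r; exact: (E_cst sE).
  apply: (E_mul_max_prefix_sum_eq0 hE) => //.
  - by move=> j mj; apply: hX; lia.
  - exact: hX0.
  - by move=> j mj; apply: X2_fin; lia.
  - by apply: hind; lia.
have tail l m : (m + l = n.+1)%N -> (1 <= m)%N ->
    (E (fun w => (M m w ^+ 2)%R) <=
      \sum_(m <= k < n.+1) E (fun w => (X k w ^+ 2)%R))%E.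
  elim: l m => [|l IH] m ml m1.
    rewrite big_geq; last lia.
    rewrite /M (_ : n.+1 - m = 0)%N; last lia.
    by under eq_fun do rewrite expr0n; rewrite (E_cst sE).
  have mn : (1 <= m <= n)%N by lia.
  rewrite big_ltn; last lia.
  apply: le_trans (leeD2l _ (IH m.+1 _ _)); [|lia|by []].
  apply: le_trans (step m mn).
  have HXM : H (fun w => X m w + M m.+1 w) := rvs_add hH (hX m mn) (HM m.+1 isT).
  apply: (E_mono sE); [exact: (rvs_sqr hH HXM)|exact: (rvs_sqr hH (HM m m1))|].
  move=> w.
  rewrite {1}/M subSn /=; last lia.
  rewrite -/(max_prefix_sum _) -subSS -/(M m.+1 w).
  by case: (leP (X m w + M m.+1 w) 0) => _ //; rewrite expr0n sqr_ge0.
rewrite big_ltn //; apply: le_trans (step 1%N _) _; first by rewrite /= hn.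
by apply: leeD2l; apply: (tail n.-1) => //; lia.
Qed.
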